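(* Let $E=[a,b]\subset\mathbb{R}$, let $m\ge 0$ be an integer, let $\theta:\mathbb{R}_+\to\mathbb{R}_+$ be a modulus of continuity (continuous, increasing, subadditive, $\theta(0)=0$), and let $(\Omega,\mathcal{F},\{\mathcal{F}_n\}_{n\ge 0},\mathcal{P})$ be a filtered probability space such that both the probability space and the filtration are complete. Let $\{(\xi_n(x), x\in E)\}_{n\ge 0}$ be a sequence of (real-valued) stochastic processes on this space such that, for every $n$, the realizations of $\xi_n$ are $C^{m+1}(E)$-smooth almost surely and the realizations of the $(m+1)$-th derivative $\xi_n^{(m+1)}$ admit the modulus of continuity $\theta$ almost surely. Set $$M_n = \|\xi_n\|_{m+1} + \sup_{x,y\in E,\ x\ne y}\frac{\left|\xi_n^{(m+1)}(x)-\xi_n^{(m+1)}(y)\right|}{\theta(|x-y|)},$$ and assume that $(\xi_n(x))_{n\ge 0}$ is a martingale with respect to $\{\mathcal{F}_n\}_{n\ge 0}$ for every fixed $x\in E$. If $$\sup_n\mathbb{E}[M_n]<+\infty,$$ then there exists a random field $(\xi(x), x\in E)$ whose realizations are almost surely $C^{m+1}(E)$-smooth and such that the realizations of its $(m+1)$-th derivative admit the modulus of continuity $\theta$ almost surely; moreover, $$\|\xi_n-\xi\|_m\underset{n\to\infty}{\longrightarrow}0$$ almost surely.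
   Context: A modulus of continuity (here always understood to be continuous, increasing, and subadditive) is a continuous increasing function $\theta:\mathbb{R}_+\to\mathbb{R}_+$ with $\theta(0)=0$ and $\theta(x+y)\le\theta(x)+\theta(y)$ for all $x,y\in\mathbb{R}_+$. A function $f$ on $E$ admits the modulus of continuity $\theta$ if and only if $$\sup_{x\ne y}\frac{|f(x)-f(y)|}{\theta(|x-y|)}<+\infty,$$ the supremum being over $x,y\in E$. For $k\ge 0$, the norm on the space $C^{k}(E)$ of $k$ times continuously differentiable functions on $E=[a,b]$ is $$\|f\|_k=\sum_{l=0}^{k}\sup_{x\in E}\left|f^{(l)}(x)\right|,$$ where $f^{(l)}$ is the $l$-th derivative of $f$ and $f^{(0)}=f$. Time is discrete ($n=0,1,2,\dots$). *)

(* Defs.v *)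
From HB Require Import structures.
From mathcomp Require Import all_boot all_order all_algebra.
From mathcomp Require Import all_classical all_reals all_analysis.
Import Order.TTheory GRing.Theory Num.Theory.
Import numFieldNormedType.Exports.

Set Implicit Arguments.
Unset Strict Implicit.
Unset Printing Implicit Defensive.

Local Open Scope classical_set_scope.
Local Open Scope ring_scope.

Section Calculus.
Context {R : realType}.
Implicit Types (E : set R) (f theta : R -> R) (k : nat).

(* Everything below only depends on the values of [f] on [E]: functions on
   [E] are represented by total functions whose values outside of [E] are
   irrelevant. In particular derivatives are limits of difference quotients
   inside [E], hence one-sided at the end points of an interval; the library
   derivative [f^`()] needs a full neighbourhood. *)
Definition derivable_in E f (x : R) : Prop :=
  cvg ((f y - f x) / (y - x) @[y --> within E x^']).

(* Meaningful only at points where [derivable_in E f x]. *)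
Definition derive_in E f : R -> R :=
  fun x => lim ((f y - f x) / (y - x) @[y --> within E x^']).

Definition derive_in_n k E f : R -> R := iter k (derive_in E) f.

Definition smooth_in k E f : Prop :=
  (forall l, (l < k)%N ->
     forall x, E x -> derivable_in E (derive_in_n l E f) x) /\
  {within E, continuous (derive_in_n k E f)}.

Definition normCk k E f : \bar R :=
  (\sum_(l < k.+1) ereal_sup [set `|derive_in_n l E f x|%:E | x in E])%E.

(* Only the values of [theta] on [0, +oo[ matter; they are nonnegative by
   monotonicity and [theta 0 = 0]. *)
Definition modulus_of_continuity theta : Prop :=
  [/\ theta 0 = 0,
      {within [set t | 0 <= t], continuous theta},
      (forall s t : R, 0 <= s -> s <= t -> theta s <= theta t) &
      (forall s t : R, 0 <= s -> 0 <= t -> theta (s + t) <= theta s + theta t)].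

(* The quotient is taken in [\bar R], where r / 0 = +oo if r > 0 and
   0 / 0 = 0. *)
Definition modulus_ratio_sup E theta f : \bar R :=
  ereal_sup [set q | exists x y, [/\ E x, E y, x != y &
    q = (`|f x - f y|%:E / (theta `|x - y|)%:E)%E]].

Definition admits_modulus E theta f : Prop :=
  (modulus_ratio_sup E theta f < +oo)%E.

End Calculus.

Section Martingales.
Context {d : measure_display} {T : measurableType d} {R : realType}
        (P : probability T R).
Implicit Types (G : set (set T)) (F : nat -> set (set T)) (X Y : T -> R).

Definition filtration F : Prop :=
  [/\ forall n, sigma_algebra [set: T] (F n),
      forall n, F n `<=` measurable &
      forall n, F n `<=` F n.+1].

Definition complete_filtration F : Prop :=
  forall n, P.-negligible `<=` F n.

(* The library's [measurable_fun] refers to the canonical sigma-algebra of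
   [T]; here [G] is a sub-sigma-algebra. *)
Definition measurable_wrt G X : Prop :=
  forall B : set R, measurable B -> G (X @^-1` B).

(* [Y] is a version of the conditional expectation of [X] given [G]. *)
Definition is_cond_expectation G X Y : Prop :=
  [/\ measurable_wrt G Y,
      P.-integrable [set: T] (EFin \o Y) &
      forall A, G A ->
        (\int[P]_(w in A) (Y w)%:E = \int[P]_(w in A) (X w)%:E)%E].

Definition martingale F (X : nat -> T -> R) : Prop :=
  [/\ forall n, measurable_wrt (F n) (X n),
      forall n, P.-integrable [set: T] (EFin \o X n) &
      forall n, is_cond_expectation (F n) (X n.+1) (X n)].

End Martingales.

(* Main.v *)
Require Import Defs.
From HB Require Import structures.
From mathcomp Require Import all_boot all_order all_algebra.
From mathcomp Require Import all_classical all_reals all_analysis.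
From mathcomp Require Import measurable_realfun ring lra.
Import Order.TTheory GRing.Theory Num.Theory.
Import numFieldNormedType.Exports.

Set Implicit Arguments.
Unset Strict Implicit.
Unset Printing Implicit Defensive.

Local Open Scope classical_set_scope.
Local Open Scope ring_scope.

(** Martingale arguments apply to finite linear combinations of the variables
    [xi n x], so derivatives are never treated as random variables: they are
    reached through the countable family [test] of iterated difference
    quotients with rational nodes. By the mean value theorem an iterated
    quotient of order [l] is a value of the [l]-th derivative at an
    intermediate point ([diff_quotient_mean_value]). Hence all tests of a
    smooth function are bounded by [M n] ([test_le_norm]), and conversely a
    common bound on all tests bounds all derivatives up to order [m.+1] and
    controls the modulus of continuity of the last one
    ([derivative_bound_of_tests], [modulus_bound_of_tests]).

    Every test of [xi n] is a martingale in [n]. The integral of the supremum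
    of all tests at time [n] is at most that of [M n], so Doob's maximal
    inequality, applied to the whole family at once ([maximal_inequality]),
    makes the tests almost surely bounded uniformly in [n] and in the test.
    Doob's upcrossing argument ([martingale_convergence]) makes each of them,
    in particular [xi n x] for each rational [x], almost surely convergent.

    What remains is deterministic ([smooth_limit]). For one realization, the
    bounds make the derivatives of all orders up to [m.+1] equicontinuous,
    uniformly in [n]. Pointwise convergence on a dense set then becomes uniform
    by compactness of [[a, b]], and uniform convergence climbs from each
    derivative to the next one, because
      | g' x - (g (x + h) - g x) / h | <= omega h
    for a common modulus omega: for each fixed [h] the quotient converges
    uniformly, and omega h is as small as desired when [h] is small
    ([derivatives_uniform_limit]). So all
    derivatives up to order [m.+1] converge uniformly, and the bound by [theta]
    passes to the limit. *)

(** * Derivatives relative to a set *)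

Section DerivativesOnASet.
Context {R : realType}.
Implicit Types (E : set R) (f g : R -> R) (G : nat -> R -> R).

(** With the denominator cleared, the point [y = x] needs no exclusion and the
    condition is stable under pointwise limits of [f]. *)
Lemma derivative_withinP E f x (D : R) :
  (f y - f x) / (y - x) @[y --> within E x^'] --> D <->
  forall e, 0 < e -> exists2 h, 0 < h & forall y, E y -> `|y - x| < h ->
    `|f y - f x - D * (y - x)| <= e * `|y - x|.
Proof.
split=> [/cvgrPdist_le cvD e e0|fD].
  have [h /= h0 hD] := cvD _ e0.
  exists h => // y Ey yh; have [->|yx] := eqVneq y x.
    by rewrite !subrr mulr0 subr0 normr0 mulr0.
  have := hD y; rewrite /ball_ /= distrC => /(_ yh yx Ey).
  have yx0 : y - x != 0 by rewrite subr_eq0.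
  rewrite distrC -(@ler_pM2r _ `|y - x|) ?normr_gt0// -normrM.
  by rewrite mulrBl divfK.
apply/cvgrPdist_le => e e0; have [h h0 hD] := fD _ e0.
exists h => //= y; rewrite /ball_ /= distrC => yh yx Ey.
have yx0 : y - x != 0 by rewrite subr_eq0.
rewrite distrC -(@ler_pM2r _ `|y - x|) ?normr_gt0// -normrM.
by rewrite mulrBl divfK//; exact: hD.
Qed.

Lemma continuous_withinP E f :
  {within E, continuous f} <-> forall x, E x ->
  forall e, 0 < e -> exists2 h, 0 < h & forall y, E y -> `|y - x| < h ->
    `|f y - f x| <= e.
Proof.
split=> [/subspace_continuousP cf x Ex e e0|cf].
  have /cvgrPdist_le /(_ _ e0) [h /= h0 hf] := cf _ Ex.
  exists h => // y Ey yx; rewrite distrC; apply: (hf y) => //.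
  by rewrite /ball_ /= distrC.
apply/subspace_continuousP => x Ex; apply/cvgrPdist_le => e e0.
have [h h0 hf] := cf _ Ex _ e0; exists h => //= y; rewrite /ball_ /= distrC => yx Ey.
by rewrite distrC; exact: hf.
Qed.

(** A sequence of total functions standing for the successive derivatives of
    [G 0]. Such chains can be subtracted and passed to the limit termwise, which
    iterated limits of difference quotients do not allow directly. *)
Definition derivatives_on E k G := forall l, (l < k)%N -> forall x, E x ->
  (G l y - G l x) / (y - x) @[y --> within E x^'] --> G l.+1 x.

Lemma derivatives_on_smooth E k f :
  smooth_in k E f -> derivatives_on E k (fun l => derive_in_n l E f).
Proof. by case=> df _ l lk x Ex; exact: df. Qed.

Lemma derivatives_on_sub E k F G : derivatives_on E k F ->
  derivatives_on E k G -> derivatives_on E k (fun l x => F l x - G l x).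
Proof.
move=> dF dG l lk x Ex; apply: cvg_trans (cvgB (dF _ lk _ Ex) (dG _ lk _ Ex)).
apply: near_eq_cvg; apply: nearW => y /=; rewrite -mulrBl; congr (_ / _).
by rewrite !fctE; ring.
Qed.

Lemma derivative_within_continuous E f x (D : R) :
  (f y - f x) / (y - x) @[y --> within E x^'] --> D ->
  forall e, 0 < e -> exists2 h, 0 < h & forall y, E y -> `|y - x| < h ->
    `|f y - f x| <= e.
Proof.
move=> /derivative_withinP /(_ _ ltr01)[h h0 fD] e e0.
have D0 : 0 < 1 + `|D| by rewrite ltr_pwDl.
exists (Order.min h (e / (1 + `|D|))); first by rewrite lt_min h0 divr_gt0.
move=> y Ey; rewrite lt_min => /andP[yh ye].
have := fD _ Ey yh; rewrite mul1r => fy.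
rewrite -(subrK (D * (y - x)) (f y - f x)); apply: le_trans (ler_normD _ _) _.
rewrite normrM; apply: le_trans (lerD fy (lexx _)) _.
rewrite -{1}[`|y - x|]mul1r -mulrDl mulrC -ler_pdivlMr//.
exact: ltW.
Qed.

Section Interval.
Variables (a b : R).
Hypothesis ab : a < b.
Let E : set R := `[a, b]%classic.

Lemma within_dnbhs_proper x : E x -> ProperFilter (within E x^').
Proof.
rewrite /E /= in_itv /= => /andP[ax xb].
apply: Build_ProperFilter_ex => A [h /= h0 hA].
have [xb'|bx] := ltP x b.
  pose y := Order.min b (x + h / 2).
  have xy : x < y by rewrite lt_min xb' ltrDl divr_gt0.
  exists y; apply: hA; rewrite /ball_ /=.
  - rewrite distrC gtr0_norm ?subr_gt0// ltrBlDl.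
    by rewrite gt_min ltrD2l ltr_pdivrMr// mulr_natr mulr2n ltrDl h0 orbT.
  - by rewrite gt_eqF.
  - by rewrite in_itv/= ge_min lexx andbT (le_trans ax (ltW xy)).
have ax' : a < x by exact: lt_le_trans bx.
pose y := Order.max a (x - h / 2).
have yx : y < x by rewrite gt_max ax' ltrBlDr ltrDl divr_gt0.
exists y; apply: hA; rewrite /ball_ /=.
- rewrite gtr0_norm ?subr_gt0// ltrBlDl -ltrBlDr.
  by rewrite lt_max ltrD2l ltrN2 ltr_pdivrMr// mulr_natr mulr2n ltrDl h0 orbT.
- by rewrite lt_eqF.
- by rewrite in_itv/= le_max lexx (le_trans (ltW yx) xb).
Qed.

(** At a point of [E] a derivative relative to [E] only sees the values on [E],
    and it is unique because [E] has no isolated point; so any chain starting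
    from [f] is the chain of derivatives of [f]. *)
Lemma derive_in_nE k f G : derivatives_on E k G ->
  (forall x, E x -> f x = G 0 x) ->
  forall l, (l <= k)%N -> forall x, E x -> derive_in_n l E f x = G l x.
Proof.
move=> dG fG; elim=> [|l ih] lk x Ex; first exact: fG.
have pF := within_dnbhs_proper Ex.
rewrite /derive_in_n iterS -/(derive_in_n l E f); apply/cvg_lim => //.
apply: cvg_trans (dG _ lk _ Ex); apply: near_eq_cvg.
rewrite near_withinE; near=> y => Ey.
by rewrite !ih// ltnW.
Unshelve. all: by end_near. Qed.

Lemma smooth_in_derivatives k f G : derivatives_on E k G ->
  (forall x, E x -> f x = G 0 x) -> {within E, continuous (G k)} ->
  smooth_in k E f.
Proof.
move=> dG fG cG; split=> [l lk x Ex|].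
  apply/cvg_ex; exists (G l.+1 x).
  apply: cvg_trans (dG _ lk _ Ex); apply: near_eq_cvg.
  rewrite near_withinE; near=> y => Ey.
  by rewrite !(derive_in_nE dG fG)// ltnW.
apply/continuous_withinP => x Ex e e0.
move/continuous_withinP : cG => /(_ _ Ex _ e0)[h h0 cG].
by exists h => // y Ey yx; rewrite !(derive_in_nE dG fG)//; exact: cG.
Unshelve. all: by end_near. Qed.

Lemma derivatives_on_continuous k G : derivatives_on E k G ->
  {within E, continuous (G k)} ->
  forall l, (l <= k)%N -> {within E, continuous (G l)}.
Proof.
move=> dG cG l; rewrite leq_eqVlt => /predU1P[->//|lk].
apply/continuous_withinP => x Ex.
exact: (derivative_within_continuous (dG _ lk _ Ex)).
Qed.

Lemma is_derive_interior f x (D : R) : x \in `]a, b[%R ->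
  (f y - f x) / (y - x) @[y --> within E x^'] --> D ->
  is_derive x 1 f D.
Proof.
rewrite in_itv/= => /andP[ax xb] fD.
apply/is_derive1_caratheodory.
exists (fun y => if y == x then D else (f y - f x) / (y - x)); split.
- move=> y; case: eqVneq => [->|yx]; first by rewrite !subrr mulr0.
  by rewrite divfK// subr_eq0.
- apply/continuous_withinNx; rewrite eqxx; apply/cvgrPdist_le => e e0.
  move/cvgrPdist_le : fD => /(_ _ e0)[h /= h0 hf].
  exists (Order.min h (Order.min (x - a) (b - x))) => /=.
    by rewrite !lt_min h0 !subr_gt0 ax xb.
  move=> y; rewrite /ball_ /= !lt_min => /and3P[yh ya yb] yx.
  rewrite (negbTE yx); apply: hf => //; rewrite /E /= in_itv /=.
  have := ler_norm (x - y); have := ler_norm (y - x); rewrite distrC.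
  by move: ya yb; lra.
- by rewrite eqxx.
Qed.

Lemma MVT_within f g x y : E x -> E y -> x < y ->
  (forall z, E z -> (f t - f z) / (t - z) @[t --> within E z^'] --> g z) ->
  exists2 c, x <= c <= y & f y - f x = g c * (y - x).
Proof.
rewrite /E /= !in_itv/= => /andP[ax xb] /andP[ay yb] xy fg.
have sub z : z \in `[x, y]%R -> E z.
  by rewrite /E /= !in_itv/= => /andP[xz zy]; rewrite (le_trans ax)// (le_trans zy).
have [z||c] := @MVT R f g x y xy.
- rewrite in_itv/= => /andP[xz zy]; apply: is_derive_interior.
    by rewrite in_itv/= (le_lt_trans ax)// (lt_le_trans zy).
  by apply: fg; apply: sub; rewrite in_itv/= !ltW.
- apply/continuous_withinP => z /sub Ez e e0.
  have [h h0 hf] := derivative_within_continuous (fg _ Ez) e0.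
  by exists h => // t /sub; exact: hf.
by move=> /subset_itv_oo_cc cxy fE; exists c.
Qed.

End Interval.

End DerivativesOnASet.
(** * Uniform limits of functions with equicontinuous derivatives *)

Lemma cvg_norm_le {R : realType} (u : nat -> R) (L c : R) (N : nat) :
  u @ \oo --> L -> (forall n, (N <= n)%N -> `|u n| <= c) -> `|L| <= c.
Proof.
move=> /cvgrPdist_le uL uc; apply/ler_addgt0Pr => e /uL [M _ uM].
have uN := uc (maxn M N) (leq_maxr _ _).
have /= LM := uM (maxn M N) (leq_maxl _ _).
rewrite -(subrK (u (maxn M N)) L); apply: le_trans (ler_normD _ _) _.
by rewrite addrC lerD.
Qed.

Section Compactness.
Context {R : realType}.
Variables (a b : R) (k : nat) (g : nat -> nat -> R -> R) (om : R -> R).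
Let E : set R := `[a, b]%classic.
Hypothesis ab : a < b.
Hypothesis om_le : forall s t, 0 <= s -> s <= t -> om s <= om t.
Hypothesis om0 : forall e, 0 < e -> exists2 h, 0 < h & om h <= e.
Hypothesis dg : forall n, derivatives_on E k (g n).
Hypothesis g_om : forall n l x y, (l <= k)%N -> E x -> E y ->
  `|g n l x - g n l y| <= om `|x - y|.
Hypothesis g_cvg : forall x h, E x -> 0 < h ->
  exists d, [/\ E d, `|x - d| < h & cvgn (fun n => g n 0 d)].

Let uniform_cauchy l := forall e, 0 < e -> exists N, forall n p x,
  (N <= n)%N -> (N <= p)%N -> E x -> `|g n l x - g p l x| <= e.

(** Equicontinuity spreads the Cauchy property from a point of convergence to a
    neighbourhood of each point; compactness makes the rank uniform. *)
Let uniform_cauchy0 : uniform_cauchy 0.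
Proof.
move=> e e0; pose Q N x := forall n p,
  (N <= n)%N -> (N <= p)%N -> E x -> `|g n 0 x - g p 0 x| <= e.
have e4 : 0 < e / 4 by rewrite divr_gt0.
have cE := (@compact_near_coveringP _ E).1 (@segment_compact R a b).
have [|N _ QN] := cE nat \oo Q _; last first.
  by exists N => n p x Nn Np Ex; exact: (QN N (leqnn N)).
move=> x Ex; have [h h0 omh] := om0 e4.
have h2 : 0 < h / 2 by rewrite divr_gt0.
have [d [Ed xd /cvg_ex[L /cvgrPdist_le /(_ _ e4)[N _ dL]]]] := g_cvg Ex h2.
exists (ball x (h / 2), [set n | (N <= n)%N]) => /=.
  by split; [exact: nbhsx_ballx|exists N].
move=> [y M] [/= xy NM] n p Mn Mp Ey.
have yd : `|y - d| <= h.
  rewrite -(subrK x y) -addrA; apply: le_trans (ler_normD _ _) _.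
  rewrite [leRHS]splitr lerD// ltW//.
  by rewrite distrC.
have near_d i : `|g i 0 y - g i 0 d| <= e / 4.
  by apply: le_trans (g_om _ _ Ey Ed) (le_trans (om_le _ yd) omh).
have := dL n (leq_trans NM Mn); have := dL p (leq_trans NM Mp) => /=.
have := near_d n; have := near_d p; rewrite !ler_distl; lra.
Qed.

(** This bound does not depend on [n], hence survives pointwise limits: it gives
    both the Cauchy property of the next derivative and the differentiability
    of the limit. *)
Let mean_value_remainder n l x y : (l < k)%N -> E x -> E y ->
  `|g n l y - g n l x - g n l.+1 x * (y - x)| <= om `|y - x| * `|y - x|.
Proof.
move=> lk Ex Ey.
suff [c /andP[Ec cx] gE] : exists2 c, (c \in E) && (`|c - x| <= `|y - x|) &
    g n l y - g n l x = g n l.+1 c * (y - x).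
  rewrite gE -mulrBl normrM ler_wpM2r//.
  apply: le_trans (om_le _ cx) => //; apply: g_om => //; exact/set_mem.
have mvt s t : E s -> E t -> s < t -> exists2 c, s <= c <= t &
    g n l t - g n l s = g n l.+1 c * (t - s).
  by move=> Es Et st; apply: (MVT_within Es Et st) => z; exact: dg.
have Emid s t c : E s -> E t -> s <= c <= t -> c \in E.
  rewrite /E /= !in_itv /= => /andP[as_ _] /andP[_ tb] /andP[sc ct].
  by rewrite inE /= in_itv/= (le_trans as_)// (le_trans ct).
have [xy|yx|->] := ltgtP x y; last 1 first.
- by exists y; [rewrite lexx andbT inE|rewrite !subrr mulr0].
- have [c cxy gE] := mvt _ _ Ex Ey xy; exists c => //.
  rewrite (Emid _ _ _ Ex Ey cxy) ger0_norm ?ger0_norm ?subr_ge0 ?(ltW xy)//.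
    by rewrite lerD2r; case/andP: cxy.
  by case/andP: cxy.
- have [c cyx gE] := mvt _ _ Ey Ex yx; exists c.
    rewrite (Emid _ _ _ Ey Ex cyx) ler0_norm ?ler0_norm ?subr_le0 ?(ltW yx)//.
      by rewrite lerN2 lerD2r; case/andP: cyx.
    by case/andP: cyx.
  by rewrite -[LHS]opprB gE -mulrN opprB.
Qed.

(** Divide the remainder bound by a step [h] so small that the error [om h] is
    at most [e / 4], then wait until the [l]-th derivatives are [e * h / 4]
    close. The step is also at most [(b - a) / 2] so that from every point of [E]
    one can move by [h] inside [E], to the right or to the left. *)
Let uniform_cauchyS l : (l < k)%N -> uniform_cauchy l -> uniform_cauchy l.+1.
Proof.
move=> lk cl e e0; have [|h' h'0 omh'] := om0 (e := e / 4); first by rewrite divr_gt0.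
pose h := Order.min h' ((b - a) / 2).
have h0 : 0 < h by rewrite lt_min h'0 divr_gt0 ?subr_gt0.
have omh : om h <= e / 4.
  by apply: le_trans omh'; apply: om_le (ltW h0) _; rewrite ge_min lexx.
have hab : h <= (b - a) / 2 by rewrite ge_min lexx orbT.
have [|N clN] := cl (e * h / 4); first by rewrite !mulr_gt0.
exists N => n p x Nn Np Ex.
have [y Ey xy] : exists2 y, E y & `|y - x| = h.
  move: Ex; rewrite /E /= in_itv/= => /andP[ax xb].
  have [xm|xm] := leP x ((a + b) / 2).
    exists (x + h); last by rewrite addrAC subrr add0r gtr0_norm.
    by rewrite in_itv/=; move: h0; lra.
  exists (x - h); last by rewrite addrAC subrr add0r normrN gtr0_norm.
  by rewrite in_itv/=; move: h0; lra.
rewrite -(ler_pM2r h0) -{1}xy -normrM.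
have := clN _ _ _ Nn Np Ex; have := clN _ _ _ Nn Np Ey.
have := mean_value_remainder p lk Ex Ey; have := mean_value_remainder n lk Ex Ey.
have : om h * h <= e * h / 4 by rewrite mulrAC ler_pM2r.
rewrite xy mulrBl.
move: (g n l.+1 x * _) (g p l.+1 x * _) (om h * h) (e * h) => A B O eh.
by rewrite !ler_norml; lra.
Qed.

Theorem derivatives_uniform_limit : exists G, derivatives_on E k G /\
  forall l, (l <= k)%N -> forall e, 0 < e -> exists N, forall n x,
    (N <= n)%N -> E x -> `|g n l x - G l x| <= e.
Proof.
have cauchy l : (l <= k)%N -> uniform_cauchy l.
  elim: l => [_|l ih lk]; first exact: uniform_cauchy0.
  by apply: uniform_cauchyS => //; apply: ih; exact: ltnW.
pose G l x := limn (fun n => g n l x).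
have gG l x : (l <= k)%N -> E x -> (fun n => g n l x) @ \oo --> G l x.
  move=> lk Ex; apply: cauchy_cvg; apply/cauchy_exP => e e0.
  have e2 : 0 < e / 2 by rewrite divr_gt0.
  have [N cN] := cauchy _ lk _ e2.
  exists (g N l x), N => // n /= Nn; rewrite /ball_/=.
  apply: (le_lt_trans (cN N n x (leqnn N) Nn Ex)).
  by rewrite ltr_pdivrMr// mulr_natr mulr2n ltrDl.
exists G; split.
  move=> l lk x Ex; apply/derivative_withinP => e e0.
  have [h h0 omh] := om0 e0; exists h => // y Ey yx.
  apply: (@cvg_norm_le _ (fun n => g n l y - g n l x - g n l.+1 x * (y - x)) _ _ 0).
    apply: cvgB; last by apply: cvgMl; exact: gG.
    by apply: cvgB; apply: gG => //; exact: ltnW.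
  move=> n _; apply: le_trans (mean_value_remainder n lk Ex Ey) _.
  by rewrite ler_wpM2r//; apply: le_trans omh; apply: om_le => //; exact: ltW.
move=> l lk e e0; have [N cN] := cauchy _ lk _ e0; exists N => n x Nn Ex.
apply: (@cvg_norm_le _ (fun p => g n l x - g p l x) _ _ N).
  by apply: cvgB; [exact: cvg_cst|exact: gG].
by move=> p Np; exact: cN.
Qed.

End Compactness.

(** * Iterated difference quotients *)

Section DifferenceQuotients.
Context {R : realType}.
Implicit Types (f : R -> R) (G : nat -> R -> R) (a b h s x : R) (k : nat).

Fixpoint diff_quotient h k f x : R :=
  if k is j.+1 then h^-1 * (diff_quotient h j f (x + h) - diff_quotient h j f x)
  else f x.

(** The operator of one difference quotient commutes with its iterates; peeling
    it off from the inside is what an induction on derivatives needs. *)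
Lemma diff_quotientS h k f x : diff_quotient h k.+1 f x =
  diff_quotient h k (fun y => h^-1 * (f (y + h) - f y)) x.
Proof. by elim: k x => [//|k ih] x; rewrite [RHS]/= -!ih. Qed.

Lemma diff_quotient_sub_shift h k f s x :
  diff_quotient h k (fun y => f y - f (y + s)) x =
  diff_quotient h k f x - diff_quotient h k f (x + s).
Proof.
elim: k x => [//|k ih] x /=; rewrite !ih -mulrBr; congr (_ * _).
by rewrite (addrAC x s h); ring.
Qed.

Lemma is_derive_shift_comp f x s (D : R) :
  is_derive (x + s) 1 f D -> is_derive x 1 (fun y => f (y + s)) D.
Proof.
move=> fD; rewrite -[D]mulr1; apply: (@is_derive1_comp _ f (fun y => y + s)) => //.
by apply: is_derive_shift.
Qed.

(** The quotients of [G] form again a chain of derivatives, on a shorter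
    interval. The induction hypothesis for that chain gives a value of a first
    quotient of [G k], to which the mean value theorem applies. *)
Lemma diff_quotient_mean_value k G a b h x : 0 < h -> a < x -> x + k%:R * h < b ->
  (forall l, (l < k)%N -> forall y, a < y < b -> is_derive y 1 (G l) (G l.+1 y)) ->
  exists2 c, x <= c <= x + k%:R * h & diff_quotient h k (G 0) x = G k c.
Proof.
move=> h0 ax; elim: k G b => [|k ih] G b xb dG.
  by exists x; rewrite // mul0r addr0 lexx.
rewrite diff_quotientS.
have kh : k.+1%:R * h = k%:R * h + h by rewrite -[in LHS]addn1 natrD mulrDl mul1r.
have [||c /andP[xc cx] ->] :=
    ih (fun l y => h^-1 * (G l (y + h) - G l y)) (b - h).
- by move: xb; rewrite kh; lra.
- move=> l lk y /andP[ay yb]; apply: is_deriveZ; apply: is_deriveB.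
    by apply: is_derive_shift_comp; apply: dG; [exact: ltnW|lra].
  by apply: dG; [exact: ltnW|lra].
have cch : c < c + h by rewrite ltrDl.
have dGk y : y \in `[c, c + h]%R -> is_derive y 1 (G k) (G k.+1 y).
  rewrite in_itv/= => /andP[cy yc]; apply: dG => //.
  by move: xb; rewrite kh; lra.
have cGk : {within `[c, c + h], continuous (G k)}.
  by apply: derivable_within_continuous => z /dGk[].
have dGk' y : y \in `]c, c + h[%R -> is_derive y 1 (G k) (G k.+1 y).
  by move=> /subset_itv_oo_cc; exact: dGk.
have [y] := MVT cch dGk' cGk.
rewrite in_itv/= => /andP[cy yc] ->; exists y; first by rewrite kh; lra.
by rewrite addrAC subrr add0r mulrC mulfK// gt_eqF.
Qed.

End DifferenceQuotients.

(** * A countable family of tests for smoothness *)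

Section Tests.
Context {R : realType}.
Variables (a b : R) (k : nat) (theta : R -> R).
Let E : set R := `[a, b]%classic.
Hypothesis ab : a < b.
Hypothesis theta_modulus : modulus_of_continuity theta.

Definition test_index : countType := (nat * rat * rat + rat * rat * rat * nat)%type.

(** The nodes and the steps are rational to keep the family countable, and the
    value is [0] when the order, a step or a node is not admissible. The second
    kind of test estimates the ratio of [g x - g (x + s)] to [theta s], for the
    [k]-th derivative [g] of [f]; as [theta s] may vanish, the ratio is the
    supremum over [j] of the ratios to [theta s + j.+1%:R^-1], which are
    finite. *)
Definition test (i : test_index) (f : R -> R) : R :=
  match i with
  | inl (l, q, r) =>
      let x : R := ratr q in let h : R := ratr r in
      if [&& (l <= k)%N, 0 < h, a < x & x + l%:R * h < b]
      then diff_quotient h l f x else 0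
  | inr (q, r, u, j) =>
      let x : R := ratr q in let h : R := ratr r in let s : R := ratr u in
      if [&& 0 < h, 0 < s, a < x & x + s + k%:R * h < b]
      then (theta s + j.+1%:R^-1)^-1 *
           (diff_quotient h k f x - diff_quotient h k f (x + s))
      else 0
  end.

Lemma theta_ge0 t : 0 <= t -> 0 <= theta t.
Proof. by case: theta_modulus => t0 _ tle _ ?; rewrite -t0 tle. Qed.

Lemma theta_small e : 0 < e -> exists2 h, 0 < h & theta h <= e.
Proof.
move=> e0; have [t0 /continuous_withinP tc _ _] := theta_modulus.
have [h h0 hth] := tc 0 (lexx 0) e e0.
have h2 : 0 < h / 2 by rewrite divr_gt0.
exists (h / 2) => //; have := hth (h / 2) (ltW h2).
rewrite t0 !subr0 (ger0_norm (ltW h2)) => th.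
apply: le_trans (ler_norm _) (th _).
by rewrite ltr_pdivrMr// mulr_natr mulr2n ltrDl.
Qed.

Section Chain.
Variable G : nat -> R -> R.
Hypothesis dG : derivatives_on E k G.

Let is_derive_chain l y : (l < k)%N -> a < y < b -> is_derive y 1 (G l) (G l.+1 y).
Proof.
move=> lk yab; apply: (is_derive_interior yab).
by apply: dG => //; rewrite /E /= in_itv/= !ltW; case/andP: yab.
Qed.

(** For the second kind of test, the difference of two quotients of [G 0] is one
    quotient of [y |-> G 0 y - G 0 (y + s)], so the mean value theorem gives both
    values of [G k] at points exactly [s] apart. *)
Lemma test_le (M : R) : 0 <= M ->
  (forall l, (l <= k)%N -> forall x, E x -> `|G l x| <= M) ->
  (forall x y, E x -> E y -> x != y -> `|G k x - G k y| <= M * theta `|x - y|) ->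
  forall i, `|test i (G 0)| <= M.
Proof.
move=> M0 GM Gth [[[l q] r]|[[[q r] u] j]] /=; case: ifPn => [|_]; rewrite ?normr0//.
  move=> /and4P[lk h0 ax xb].
  have [|c /andP[xc cx] ->] := diff_quotient_mean_value (G := G) h0 ax xb.
    by move=> i il y; apply: is_derive_chain; exact: leq_trans lk.
  by apply: GM => //; rewrite /E /= in_itv/=; lra.
move=> /and4P[h0 s0 ax xb].
have xb' : ratr q + k%:R * ratr r < b - ratr u by lra.
have kh : 0 <= k%:R * ratr r :> R by rewrite mulr_ge0// ltW.
rewrite -diff_quotient_sub_shift.
have [|c /andP[xc cx] ->] :=
    diff_quotient_mean_value (G := fun l y => G l y - G l (y + ratr u)) h0 ax xb'.
  move=> i il y /andP[ay yb]; apply: is_deriveB.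
    by apply: is_derive_chain => //; lra.
  by apply: is_derive_shift_comp; apply: is_derive_chain => //; lra.
set s := ratr u; have j0 : 0 < j.+1%:R^-1 :> R by rewrite invr_gt0.
have ts0 := theta_ge0 (ltW s0).
have c0 : 0 < theta s + j.+1%:R^-1 by rewrite ltr_wpDl.
rewrite normrM gtr0_norm ?invr_gt0// mulrC ler_pdivrMr//.
apply: (@le_trans _ _ (M * theta s)); last first.
  by rewrite ler_wpM2l// lerDl ltW.
have := Gth c (c + s); rewrite opprD addrA subrr add0r normrN (gtr0_norm s0).
apply; rewrite ?/E /= ?in_itv/=; move: s0; rewrite -/s; lra.
Qed.

(** Endpoints of [E] are approached from inside, with a whole range of admissible
    steps, so that one step can serve two nodes at the same time. *)
Lemma rational_near_point x e : E x -> 0 < e -> exists q : rat, exists2 h0, 0 < h0 &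
  forall l h, (l <= k)%N -> 0 < h <= h0 -> [/\ a < ratr q, x - e < ratr q,
    ratr q + l%:R * h < b & ratr q + l%:R * h < x + e].
Proof.
rewrite /E /= in_itv/= => /andP[ax xb] e0.
have : Order.max a (x - e) < Order.min b (x + e).
  by rewrite lt_min !gt_max ab; lra.
move=> /rat_in_itvoo[q]; rewrite in_itv/= gt_max lt_min.
move=> /andP[/andP[aq xq] /andP[qb qx]].
have d0 : 0 < Order.min b (x + e) - ratr q by rewrite subr_gt0 lt_min qb.
exists q, ((Order.min b (x + e) - ratr q) / k.+1%:R); first by rewrite divr_gt0.
move=> l h lk /andP[h0 hh].
have lh : ratr q + l%:R * h < Order.min b (x + e).
  rewrite -ltrBrDl; move: hh; rewrite ler_pdivlMr// mulrC => hh.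
  by apply: lt_le_trans hh; rewrite ltr_pM2r// ltr_nat ltnS.
by move: lh; rewrite lt_min => /andP[? ?]; split.
Qed.

Variable K : R.
Hypothesis cG : {within E, continuous (G k)}.
Hypothesis GK : forall i, `|test i (G 0)| <= K.

Let cGl l x e : (l <= k)%N -> E x -> 0 < e -> exists2 h, 0 < h &
  forall y, E y -> `|y - x| < h -> `|G l y - G l x| <= e.
Proof.
move=> lk; have /continuous_withinP := derivatives_on_continuous dG cG lk.
by move=> + Ex e0 => /(_ x Ex e e0).
Qed.

(** A test with node close to [x] and small step is a value of [G l] close to
    [x], and [G l] is continuous. *)
Lemma derivative_bound_of_tests l x : (l <= k)%N -> E x -> `|G l x| <= K.
Proof.
move=> lk Ex; apply/ler_addgt0Pr => e e0.
have [d d0 Gd] := cGl lk Ex e0.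
have [q [h0 h00 qh]] := rational_near_point Ex d0.
have /rat_in_itvoo[r] := h00; rewrite in_itv/= => /andP[r0 rh].
have [|ax xd xb dx] := qh l (ratr r) lk; first by rewrite r0 ltW.
have := GK (inl (l, q, r)); rewrite /= lk r0 ax xb/=.
have [|c /andP[xc cx] ->] := diff_quotient_mean_value (G := G) r0 ax xb.
  by move=> i il y; apply: is_derive_chain; exact: leq_trans lk.
move=> GcK; rewrite -(subrK (G l c) (G l x)); apply: le_trans (ler_normD _ _) _.
rewrite addrC lerD// distrC; apply: Gd; last by rewrite ltr_distl; lra.
by rewrite /E /= in_itv/=; lra.
Qed.

(** Same approximation at [x] and [y] at once. The nodes are at distance
    [s <= y - x + t0], and subadditivity bounds [theta s] by
    [theta (y - x) + theta t0]. *)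
Lemma modulus_bound_of_tests x y : E x -> E y ->
  `|G k x - G k y| <= K * theta `|x - y|.
Proof.
wlog xy : x y / x < y => [wlg Ex Ey|].
  have [xy|yx|->] := ltgtP x y; [exact: wlg| |].
    by rewrite distrC (distrC x); exact: wlg.
  by rewrite !subrr normr0; case: theta_modulus => -> _ _ _; rewrite mulr0.
move=> Ex Ey; have K0 : 0 <= K := le_trans (normr_ge0 _) (GK (inl (0, 0, 0))).
rewrite (distrC x) (@gtr0_norm _ (y - x)) ?subr_gt0//; apply/ler_addgt0Pr => e e0.
(* [e1] is spent once for [theta t0] and once for [j.+1%:R^-1], both times with a
   factor [K], and once for each of the two continuity estimates. *)
pose e1 := e / (2 * K + 2).
have e10 : 0 < e1 by rewrite divr_gt0//; lra.
have eE : e = 2 * K * e1 + 2 * e1 by rewrite -mulrDl mulrC divfK//; lra.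
have [t0 t00 tht] := theta_small e10.
have [d1 d10 Gx] := cGl (leqnn k) Ex e10.
have [d2 d20 Gy] := cGl (leqnn k) Ey e10.
pose d := Order.min (Order.min d1 d2) (Order.min ((y - x) / 2) (t0 / 2)).
have d0 : 0 < d by rewrite !lt_min d10 d20 !divr_gt0 ?subr_gt0.
have [dd1 dd2 dxy dt] : [/\ d <= d1, d <= d2, d <= (y - x) / 2 & d <= t0 / 2].
  by rewrite !ge_min !lexx ?orbT.
have [q [h0 h00 qh]] := rational_near_point Ex d0.
have [q' [h0' h00' qh']] := rational_near_point Ey d0.
have /rat_in_itvoo[r] : 0 < Order.min h0 h0' by rewrite lt_min h00.
rewrite in_itv/= lt_min => /and3P[r0 rh rh'].
have [|ax xd xb dx] := qh k (ratr r) (leqnn k); first by rewrite r0 ltW.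
have [|ay yd yb dy] := qh' k (ratr r) (leqnn k); first by rewrite r0 ltW.
have kr : 0 <= k%:R * ratr r :> R by rewrite mulr_ge0// ltW.
have qq' : ratr q + ratr (q' - q) = ratr q' :> R by rewrite rmorphB addrC subrK.
pose s : R := ratr (q' - q); have sE : s = ratr q' - ratr q by rewrite /s rmorphB.
have s0 : 0 < s by clear - sE dx yd dxy kr; lra.
pose j := Num.truncn e1^-1.
have je1 : j.+1%:R^-1 <= e1.
  rewrite -[leRHS]invrK lef_pV2 ?posrE ?invr_gt0//; exact/ltW/truncnS_gt.
have j0 : 0 < j.+1%:R^-1 :> R by rewrite invr_gt0.
have [_ _ th_le th_sub] := theta_modulus.
have ths : theta s <= theta (y - x) + e1.
  have yx0 : 0 <= y - x by rewrite subr_ge0 ltW.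
  apply: (@le_trans _ _ (theta (y - x + t0))).
    by apply: th_le; clear - s0 sE dy xd dt kr; lra.
  by apply: le_trans (th_sub _ _ yx0 (ltW t00)) _; rewrite lerD2l.
have := GK (inr (q, r, q' - q, j)); rewrite /= -/s r0 s0 ax qq' yb /=.
have [|c /andP[xc cx] ->] := diff_quotient_mean_value (G := G) r0 ax xb.
  by move=> i il z; exact: is_derive_chain.
have [|c' /andP[yc cy] ->] := diff_quotient_mean_value (G := G) r0 ay yb.
  by move=> i il z; exact: is_derive_chain.
have ts0 := theta_ge0 (ltW s0).
have c0 : 0 < theta s + j.+1%:R^-1 by rewrite ltr_wpDl.
rewrite normrM gtr0_norm ?invr_gt0// mulrC ler_pdivrMr// => Gcc'.
have {}Gcc' : `|G k c - G k c'| <= K * (theta (y - x) + e1 + e1).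
  by apply: le_trans Gcc' _; rewrite ler_wpM2l// (le_trans (lerD ths je1)).
have : `|G k c - G k x| <= e1.
  apply: Gx; rewrite ?ltr_distl /E /= ?in_itv/=; clear - ax xb xd dx xc cx kr dd1; lra.
have : `|G k c' - G k y| <= e1.
  apply: Gy; rewrite ?ltr_distl /E /= ?in_itv/=; clear - ay yb yd dy yc cy kr dd2; lra.
move: Gcc'; rewrite eE !mulrDr -[2 * K * e1]mulrA.
move: (K * e1) (K * theta _) => A B; rewrite !ler_norml; clear - ab dG; lra.
Qed.

End Chain.
End Tests.

(** * The limit of one realization *)

Section DeterministicLimit.
Context {R : realType}.
Variables (a b : R) (k : nat) (theta : R -> R).
Let E : set R := `[a, b]%classic.
Hypothesis ab : a < b.
Hypothesis theta_modulus : modulus_of_continuity theta.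

(** A single modulus, [om t = K * t + K * theta t], serves all orders: below [k]
    the functions are [K]-Lipschitz, at order [k] the bound is [K * theta]. *)
Lemma limit_of_bounded_tests (f : nat -> R -> R) (K : R) :
  (forall n, smooth_in k E (f n)) ->
  (forall n i, `|test a b k theta i (f n)| <= K) ->
  (forall q : rat, a < ratr q < b -> cvgn (fun n => f n (ratr q))) ->
  exists G, [/\ derivatives_on E k G, {within E, continuous (G k)},
    forall x y, E x -> E y -> `|G k x - G k y| <= K * theta `|x - y| &
    forall l, (l <= k)%N -> forall e, 0 < e -> exists N, forall n x,
      (N <= n)%N -> E x -> `|derive_in_n l E (f n) x - G l x| <= e].
Proof.
move=> sf fK f_cvg.
have K0 : 0 <= K := le_trans (normr_ge0 _) (fK 0 (inl (0, 0, 0))).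
pose g n l := derive_in_n l E (f n).
have dg n : derivatives_on E k (g n) by exact: derivatives_on_smooth.
have cg n : {within E, continuous (g n k)} by case: (sf n).
have gK n l x : (l <= k)%N -> E x -> `|g n l x| <= K.
  by move=> lk Ex; apply: (derivative_bound_of_tests ab (dg n) (cg n) (fK n)).
have gth n x y : E x -> E y -> `|g n k x - g n k y| <= K * theta `|x - y|.
  by move=> Ex Ey; apply: (modulus_bound_of_tests ab theta_modulus (dg n) (cg n) (fK n)).
have [_ _ th_le _] := theta_modulus.
have th0 t : 0 <= t -> 0 <= theta t by exact: (theta_ge0 theta_modulus).
pose om t := K * t + K * theta t.
have om_le s t : 0 <= s -> s <= t -> om s <= om t.
  by move=> s0 st; rewrite lerD// ler_wpM2l// th_le.
have g_lip n l x y : (l < k)%N -> E x -> E y -> x < y ->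
    `|g n l y - g n l x| <= K * `|y - x|.
  move=> lk Ex Ey xy.
  have [c cxy ->] := MVT_within Ex Ey xy (dg n l lk).
  rewrite normrM ler_wpM2r// gK//.
  by move: Ex Ey cxy; rewrite /E /= !in_itv/=; lra.
have g_om n l x y : (l <= k)%N -> E x -> E y -> `|g n l x - g n l y| <= om `|x - y|.
  have K1 t : 0 <= t -> 0 <= K * t /\ 0 <= K * theta t.
    by move=> t0; rewrite !mulr_ge0 ?th0.
  have [K2 K3] := K1 _ (normr_ge0 (x - y)).
  rewrite leq_eqVlt => /predU1P[-> Ex Ey|lk Ex Ey].
    by apply: le_trans (gth n x y Ex Ey) _; rewrite lerDr.
  apply: (@le_trans _ _ (K * `|x - y|)); last by rewrite lerDl.
  have [xy|yx|->] := ltgtP x y.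
  - by rewrite distrC (distrC x); exact: g_lip.
  - exact: g_lip.
  - by rewrite !subrr normr0 mulr0.
have om0 e : 0 < e -> exists2 h, 0 < h & om h <= e.
  move=> e0; have e1 : 0 < e / (2 * (K + 1)) by rewrite divr_gt0//; lra.
  have [t t0 tht] := theta_small theta_modulus e1.
  have eE : e = 2 * (K + 1) * (e / (2 * (K + 1))) by rewrite mulrC divfK//; lra.
  move: (e / _) e1 tht eE => e1 e10 tht eE.
  exists (Order.min t e1); first by rewrite lt_min t0.
  have m0 : 0 <= Order.min t e1 by rewrite le_min !ltW.
  have : K * Order.min t e1 <= K * e1 by rewrite ler_wpM2l// ge_min lexx orbT.
  have : K * theta (Order.min t e1) <= K * e1.
    rewrite ler_wpM2l//; apply: le_trans tht; apply: th_le => //.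
    by rewrite ge_min lexx.
  by rewrite /om eE => ? ?; lra.
have g_cvg x h : E x -> 0 < h ->
    exists d, [/\ E d, `|x - d| < h & cvgn (fun n => g n 0 d)].
  rewrite /E /= in_itv/= => xab h0.
  have : Order.max a (x - h) < Order.min b (x + h) by rewrite lt_min !gt_max ab; lra.
  move=> /rat_in_itvoo[q]; rewrite in_itv/= gt_max lt_min => qx.
  exists (ratr q); split; last by apply: f_cvg; lra.
    by rewrite in_itv/=; lra.
  by rewrite ltr_distl; lra.
have [G [dG gG]] := derivatives_uniform_limit ab om_le om0 dg g_om g_cvg.
have g_to_G l x : (l <= k)%N -> E x -> (fun n => g n l x) @ \oo --> G l x.
  move=> lk Ex; apply/cvgrPdist_le => e e0; have [N gN] := gG l lk e e0.
  by exists N => // n /= Nn; rewrite distrC; exact: gN.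
have Gth x y : E x -> E y -> `|G k x - G k y| <= K * theta `|x - y|.
  move=> Ex Ey; apply: (@cvg_norm_le _ (fun n => g n k x - g n k y) _ _ 0).
    by apply: cvgB; exact: g_to_G.
  by move=> n _; exact: gth.
exists G; split => //.
apply/continuous_withinP => x Ex e e0.
have [h h0 omh] := om0 e e0; exists h => // y Ey yx.
apply: le_trans (Gth _ _ Ey Ex) (le_trans _ omh).
apply: (@le_trans _ _ (om `|y - x|)); first by rewrite lerDr mulr_ge0.
by apply: om_le => //; exact: ltW.
Qed.

Lemma ereal_cvg0 (u : nat -> \bar R) : (forall n, (0 <= u n)%E) ->
  (forall e, 0 < e -> exists N, forall n, (N <= n)%N -> (u n <= e%:E)%E) ->
  u @ \oo --> 0%E.
Proof.
move=> u0 ue; apply/fine_cvgP; split.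
  have [N uN] := ue 1 ltr01; exists N => // n /= /uN un.
  by rewrite ge0_fin_numE//; apply: le_lt_trans un (ltry _).
apply/cvgrPdist_le => e e0; have [N uN] := ue e e0; exists N => // n /= /uN un.
rewrite sub0r normrN ger0_norm; last by apply: fine_ge0.
by rewrite -lee_fin fineK// ge0_fin_numE//; apply: le_lt_trans un (ltry _).
Qed.

Lemma ereal_sup_image_le (f : R -> R) (e : R) :
  (forall x, E x -> `|f x| <= e) ->
  (ereal_sup [set `|f x|%:E | x in E] <= e%:E)%E.
Proof. by move=> fe; apply: ge_ereal_sup => _ [x Ex <-]; rewrite lee_fin; exact: fe. Qed.

Lemma ereal_sup_image_ub (f : R -> R) x : E x ->
  (`|f x|%:E <= ereal_sup [set `|f x|%:E | x in E])%E.
Proof. by move=> Ex; apply: ereal_sup_ubound; exists x. Qed.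

Let Ea : E a. Proof. by rewrite /E /= in_itv/= lexx ltW. Qed.

Lemma ereal_sup_image_ge0 (f : R -> R) :
  (0 <= ereal_sup [set `|f x|%:E | x in E])%E.
Proof. by apply: le_trans (ereal_sup_image_ub _ Ea); rewrite lee_fin. Qed.

Lemma normCk_ge0 j f : (0 <= normCk j E f)%E.
Proof. by apply: sume_ge0 => l _; exact: ereal_sup_image_ge0. Qed.

Lemma normCk_ub j f l x : (l <= j)%N -> E x ->
  (`|derive_in_n l E f x|%:E <= normCk j E f)%E.
Proof.
rewrite -ltnS => lj Ex; apply: le_trans (ereal_sup_image_ub _ Ex) _.
rewrite /normCk (bigD1 (Ordinal lj))//= leeDl// sume_ge0// => i _.
exact: ereal_sup_image_ge0.
Qed.

Lemma normCk_cvg0 j (f : nat -> R -> R) :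
  (forall l, (l <= j)%N -> forall e, 0 < e -> exists N, forall n x,
      (N <= n)%N -> E x -> `|derive_in_n l E (f n) x| <= e) ->
  normCk j E (f n) @[n --> \oo] --> 0%E.
Proof.
move=> f0; apply: ereal_cvg0 => [n|e e0]; first exact: normCk_ge0.
have e1 : 0 < e / j.+1%:R by rewrite divr_gt0.
have /choice[N fN] : forall l, exists N, (l <= j)%N -> forall n x,
    (N <= n)%N -> E x -> `|derive_in_n l E (f n) x| <= e / j.+1%:R.
  move=> l; have [lj|_] := leqP l j; last by exists 0.
  by have [N fN] := f0 l lj _ e1; exists N.
exists (\max_(l < j.+1) N l)%N => n Nn.
apply: (@le_trans _ _ (\sum_(l < j.+1) (e / j.+1%:R)%:E)%E); last first.
  by rewrite sumEFin lee_fin sumr_const card_ord -(mulr_natr (e / _)) divfK ?pnatr_eq0.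
apply: lee_sum => l _; apply: ereal_sup_image_le => x Ex; apply: fN => //.
  by rewrite -ltnS.
exact: leq_trans (leq_bigmax l) Nn.
Qed.

Lemma modulus_ratio_sup_ge0 f : (0 <= modulus_ratio_sup E theta f)%E.
Proof.
have Eb : E b by rewrite /E /= in_itv/= lexx ltW.
apply: (@le_trans _ _ (`|f a - f b|%:E / (theta `|a - b|)%:E)%E).
  by rewrite mule_ge0 ?lee_fin// inve_ge0 lee_fin (theta_ge0 theta_modulus).
by apply: ereal_sup_ubound; exists a, b; split => //; rewrite lt_eqF.
Qed.

(** Also correct where [theta] vanishes: then the quotient is [0] or [+oo]
    according to whether the numerator vanishes. *)
Lemma modulus_ratio_sup_le f (M : R) : 0 <= M ->
  (modulus_ratio_sup E theta f <= M%:E)%E <->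
  (forall x y, E x -> E y -> x != y -> `|f x - f y| <= M * theta `|x - y|).
Proof.
move=> M0.
have key u t : 0 <= u -> 0 <= t -> (u%:E / t%:E <= M%:E)%E = (u <= M * t).
  move=> u0; rewrite le_eqVlt => /predU1P[<-|t0].
    rewrite mulr0 inve0; move: u0; rewrite le_eqVlt => /predU1P[<-|u0].
      by rewrite mul0e lee_fin M0 lexx.
    by rewrite gt0_muley ?lte_fin// leye_eq/= leNgt u0.
  by rewrite inver gt_eqF// -EFinM lee_fin ler_pdivrMr.
split=> [fM x y Ex Ey xy|fM].
  rewrite -key// ?(theta_ge0 theta_modulus)//; apply: le_trans fM.
  by apply: ereal_sup_ubound; exists x, y.
apply: ge_ereal_sup => _ [x [y [Ex Ey xy ->]]].
by rewrite key ?(theta_ge0 theta_modulus)//; exact: fM.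
Qed.

(** The limit function is only prescribed at points where convergence holds, so
    that [phi] may be defined by [limn] before convergence is known. *)
Theorem smooth_limit (f : nat -> R -> R) (phi : R -> R) (K : R) :
  (forall n, smooth_in k E (f n)) ->
  (forall n i, `|test a b k theta i (f n)| <= K) ->
  (forall q : rat, a < ratr q < b -> cvgn (fun n => f n (ratr q))) ->
  (forall x, E x -> cvgn (fun n => f n x) -> phi x = limn (fun n => f n x)) ->
  [/\ forall x, E x -> cvgn (fun n => f n x), smooth_in k E phi,
    admits_modulus E theta (derive_in_n k E phi) &
    forall j, (j <= k)%N ->
      normCk j E (fun x => f n x - phi x) @[n --> \oo] --> 0%E].
Proof.
move=> sf fK f_cvg phiE.
have K0 : 0 <= K := le_trans (normr_ge0 _) (fK 0 (inl (0, 0, 0))).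
have [G [dG cG Gth gG]] := limit_of_bounded_tests sf fK f_cvg.
have fG x : E x -> (fun n => f n x) @ \oo --> G 0 x.
  move=> Ex; apply/cvgrPdist_le => e e0; have [N gN] := gG 0 (leq0n k) e e0.
  by exists N => // n /= Nn; rewrite distrC; exact: gN.
have phiG x : E x -> phi x = G 0 x.
  move=> Ex; rewrite phiE//; last by apply: cvgP; exact: fG.
  by apply/cvg_lim => //; exact: fG.
split.
- by move=> x Ex; apply: cvgP; exact: fG.
- exact: (smooth_in_derivatives ab dG).
- apply: le_lt_trans (ltry K); apply/modulus_ratio_sup_le => // x y Ex Ey _.
  by rewrite !(derive_in_nE ab dG phiG)//; exact: Gth.
move=> j jk; apply: normCk_cvg0 => l lj e e0.
have lk := leq_trans lj jk.
have [N gN] := gG l lk e e0; exists N => n x Nn Ex.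
have dfG := derivatives_on_sub (derivatives_on_smooth (sf n)) dG.
by rewrite (derive_in_nE ab dfG)//; [exact: gN|move=> y Ey; rewrite phiG].
Qed.

Lemma test_le_norm f i : smooth_in k E f ->
  (`|test a b k theta i f|%:E <=
    normCk k E f + modulus_ratio_sup E theta (derive_in_n k E f))%E.
Proof.
move=> sf; set M := (_ + _)%E.
have nM : (normCk k E f <= M)%E by rewrite leeDl// modulus_ratio_sup_ge0.
have rM : (modulus_ratio_sup E theta (derive_in_n k E f) <= M)%E.
  by rewrite leeDr// normCk_ge0.
have M0 : (0 <= M)%E by rewrite adde_ge0// ?normCk_ge0// modulus_ratio_sup_ge0.
case: M M0 nM rM => [M||] //= M0 nM rM; rewrite ?leey// lee_fin.
apply: (test_le theta_modulus (derivatives_on_smooth sf)) => //.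
  by move=> l lk x Ex; rewrite -lee_fin; apply: le_trans nM; exact: normCk_ub.
by apply/modulus_ratio_sup_le.
Qed.

End DeterministicLimit.

(** * Upcrossings and convergence of real sequences *)

Section RealSequences.
Context {R : realType}.
Implicit Types (x : nat -> R) (p q : R).

(** At time [n] an upcrossing of [[p, q]] is under way: the sequence has gone
    below [p] and has not exceeded [q] since. *)
Fixpoint climbing p q x n : bool :=
  if n is k.+1 then if climbing p q x k then x n <= q else x n < p
  else x 0 < p.

(** Once no upcrossing is completed any more, a visit below [p] confines the
    sequence below [q] forever; so it cannot keep oscillating between two
    rationals, and it converges to the supremum of its eventual lower bounds. *)
Lemma bounded_cvg_of_upcrossings x K : (forall n, `|x n| <= K) ->
  (forall p q : rat, p < q -> exists N, forall n, (N <= n)%N ->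
    climbing (ratr p) (ratr q) x n -> x n.+1 <= ratr q) ->
  cvgn x.
Proof.
move=> xK up.
have stays p q N : p < q ->
    (forall n, (N <= n)%N -> climbing p q x n -> x n.+1 <= q) ->
    (exists2 n, (N <= n)%N & x n < p) ->
    exists M, forall n, (M <= n)%N -> x n <= q.
  move=> pq upN [n0 Nn0 xp].
  have cl0 : climbing p q x n0.
    case: n0 Nn0 xp => [//|n0] _ xp /=; case: ifP => // _.
    exact: ltW (lt_trans xp pq).
  have cl k : climbing p q x (n0 + k).
    elim: k => [|k ih]; first by rewrite addn0.
    rewrite addnS /= ih; apply: upN => //; apply: leq_trans Nn0 _.
    exact: leq_addr.
  exists n0.+1 => n; case: n => // n; rewrite ltnS => /subnKC <-.
  by apply: upN => //; apply: leq_trans Nn0 _; exact: leq_addr.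
pose S := [set p | exists N, forall n, (N <= n)%N -> p <= x n].
have supS : has_sup S.
  split; first by exists (- K), 0 => n _; have := xK n; rewrite ler_norml => /andP[].
  exists K => p [N /(_ N (leqnn N)) pN]; apply: le_trans pN _.
  by have := xK N; rewrite ler_norml => /andP[].
apply/cvg_ex; exists (sup S); apply/cvgrPdist_le => e e0.
have [s [N Ns] se] := sup_adherent e0 supS.
have /rat_in_itvoo[p] : sup S < sup S + e by rewrite ltrDl.
rewrite in_itv /= => /andP[Sp] /rat_in_itvoo[q].
rewrite in_itv /= => /andP[pq qe].
move: pq; rewrite ltr_rat => pq.
have [N' upN'] := up _ _ pq.
(* [p] exceeds the limit inferior, so [x] keeps returning below [p]. *)
have pqR : ratr p < ratr q :> R by rewrite ltr_rat.
have [|M xM] := @stays (ratr p) (ratr q) N' pqR upN'.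
  apply: contrapT => nx.
  have : S (ratr p).
    exists N' => n Nn; rewrite leNgt; apply/negP => xp; apply: nx.
    by exists n.
  move=> /(ub_le_sup supS.2); rewrite leNgt => /negP; exact.
near=> n.
rewrite distrC ler_distl; apply/andP; split.
  by apply: le_trans (ltW se) _; apply: Ns; near: n; exact: nbhs_infty_ge.
apply: le_trans (ltW qe); apply: xM; near: n; exact: nbhs_infty_ge.
Unshelve. all: by end_near. Qed.

End RealSequences.

(** * Martingales *)

Section SigmaAlgebra.
Context {d : measure_display} {T : measurableType d} {R : realType}.
Context {G : set (set T)} (sG : sigma_algebra [set: T] G).
Implicit Types (A B : set T) (X Y : T -> R).

Lemma sigma_algebraI A B : G A -> G B -> G (A `&` B).
Proof.
have <- := measurable_g_measurableTypeE sG.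
exact: (@measurableI _ (g_sigma_algebraType G)).
Qed.

Lemma sigma_algebraU A B : G A -> G B -> G (A `|` B).
Proof.
have <- := measurable_g_measurableTypeE sG.
exact: (@measurableU _ (g_sigma_algebraType G)).
Qed.

Lemma sigma_algebra_compl A : G A -> G (~` A).
Proof.
have <- := measurable_g_measurableTypeE sG.
exact: (@measurableC _ (g_sigma_algebraType G)).
Qed.

Lemma measurable_wrtP X :
  measurable_wrt G X <->
  measurable_fun [set: g_sigma_algebraType G] (X : g_sigma_algebraType G -> R).
Proof.
have GE := measurable_g_measurableTypeE sG; split => [mX _ B mB|mX B mB].
  by rewrite setTI GE; exact: mX.
by rewrite -GE -[X in measurable X]setTI; exact: mX.
Qed.

Lemma measurable_wrt_scale_sub (c : R) X Y :
  measurable_wrt G X -> measurable_wrt G Y ->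
  measurable_wrt G (fun w => c * (X w - Y w)).
Proof.
move=> /measurable_wrtP mX /measurable_wrtP mY; apply/measurable_wrtP.
by apply: measurable_funM => //; exact: measurable_funB.
Qed.

Lemma measurable_wrt_norm X :
  measurable_wrt G X -> measurable_wrt G (fun w => `|X w|).
Proof.
move=> /measurable_wrtP mX; apply/measurable_wrtP.
exact: measurableT_comp.
Qed.

Lemma measurable_wrt_gt X (t : R) : measurable_wrt G X -> G [set w | t < X w].
Proof.
by move=> mX; have := mX _ (measurable_itv `]t, +oo[); rewrite set_itvE.
Qed.

Lemma measurable_wrt_lt X (t : R) : measurable_wrt G X -> G [set w | X w < t].
Proof.
by move=> mX; have := mX _ (measurable_itv `]-oo, t[); rewrite set_itvE.
Qed.

End SigmaAlgebra.

Section Martingales.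
Context {d : measure_display} {T : measurableType d} {R : realType}
        {P : probability T R} {F : nat -> set (set T)}.
Hypothesis filtF : filtration F.
Implicit Types (X Y : nat -> T -> R) (A B : set T).

Lemma filtration_sigma_algebra n : sigma_algebra [set: T] (F n).
Proof. by case: filtF. Qed.

Lemma filtration_measurable n A : F n A -> measurable A.
Proof. by case: filtF => _ + _; apply. Qed.

Lemma filtration_le n p A : (n <= p)%N -> F n A -> F p A.
Proof.
move=> /subnKC <-; elim: (p - n)%N => [|k ih] FA; first by rewrite addn0.
by rewrite addnS; case: filtF => _ _; apply; exact: ih.
Qed.

Lemma filtration_seqDU E n :
  (forall k, (k <= n)%N -> F k (E k)) -> F n (seqDU E n).
Proof.
move=> FE; apply: (sigma_algebraI (filtration_sigma_algebra n)).
  exact: FE.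
apply: (sigma_algebra_compl (filtration_sigma_algebra n)).
have FE' (k : 'I_n) : F n (E k).
  by apply: (@filtration_le k); [exact: ltnW|apply/FE/ltnW].
elim/big_ind : _ => //.
- by case: (filtration_sigma_algebra n).
- exact: (sigma_algebraU (filtration_sigma_algebra n)).
Qed.

(** Difference quotients and differences of them are built from this one
    operation; with [c = 0] it also gives the null martingale. *)
Lemma martingale_scale_sub (c : R) X Y :
  martingale P F X -> martingale P F Y ->
  martingale P F (fun n w => c * (X n w - Y n w)).
Proof.
case=> mX iX eX [mY iY eY].
have mZ n : measurable_wrt (F n) (fun w => c * (X n w - Y n w)).
  exact: (measurable_wrt_scale_sub (filtration_sigma_algebra n)).
have iZ n : P.-integrable [set: T] (EFin \o (fun w => c * (X n w - Y n w))).
  apply: (eq_integrable _ (fun w => c%:E * ((EFin \o X n) w - (EFin \o Y n) w))%E) => //.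
  by apply: integrableZl => //; exact: integrableB.
have iA (Z : T -> R) A : measurable A -> P.-integrable [set: T] (EFin \o Z) ->
    P.-integrable A (EFin \o Z).
  by move=> mA; exact: integrableS.
split=> // n; split=> // A FA.
have mA := filtration_measurable FA.
have intE k : (\int[P]_(w in A) (c * (X k w - Y k w))%:E =
    c%:E * (\int[P]_(w in A) (X k w)%:E - \int[P]_(w in A) (Y k w)%:E))%E.
  rewrite -integralB//; [|exact: iA..].
  rewrite -integralZl//.
  by apply: integrableB => //; exact: iA.
rewrite !intE; congr (_ * (_ - _))%E.
- by case: (eX n) => _ _; exact.
- by case: (eY n) => _ _; exact.
Qed.

Lemma martingale_integral X n p A : martingale P F X -> (n <= p)%N -> F n A ->
  (\int[P]_(w in A) (X n w)%:E = \int[P]_(w in A) (X p w)%:E)%E.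
Proof.
move=> [_ _ eX] /subnKC <-; elim: (p - n)%N => [|k ih] FA; first by rewrite addn0.
rewrite addnS ih//; case: (eX (n + k)%N) => _ _; apply.
by apply: filtration_le FA; exact: leq_addr.
Qed.

Lemma martingale_measurable X n : martingale P F X -> measurable_fun [set: T] (X n).
Proof. by case=> _ /(_ n) /measurable_int /measurable_EFinP. Qed.

(** The absolute value of a martingale is a submartingale: on each of the two
    parts of [A] where [X n] has constant sign, the absolute value can be moved
    outside the integral, which [martingale_integral] preserves. *)
Lemma martingale_abs_integral X n p A : martingale P F X -> (n <= p)%N -> F n A ->
  (\int[P]_(w in A) `|X n w|%:E <= \int[P]_(w in A) `|X p w|%:E)%E.
Proof.
move=> mX np FA.
have mXn k := martingale_measurable k mX.
have mabs k D : measurable_fun D (fun w => `|X k w|%:E).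
  apply: (measurable_funS measurableT) => //.
  by apply/measurable_EFinP; exact: measurableT_comp.
pose N := [set w | X n w < 0].
have FN : F n N by case: mX => + _ _ => /(_ n); exact: measurable_wrt_lt.
have FI := sigma_algebraI (filtration_sigma_algebra n).
have FAN : F n (A `&` N) by exact: FI.
have FAP : F n (A `\` N).
  by apply: FI => //; exact: sigma_algebra_compl (filtration_sigma_algebra n) _ _.
have mAN := filtration_measurable FAN.
have mAP := filtration_measurable FAP.
have iX k D : measurable D -> P.-integrable D (EFin \o X k).
  by move=> mD; apply: (integrableS measurableT) => //; case: mX.
have AE : A = (A `\` N) `|` (A `&` N) by rewrite setUC setUIDK.
have dAN : [disjoint A `\` N & A `&` N] by apply/disj_setPS => w [[_ ?] [_ ?]].
rewrite {1 2}AE !ge0_integral_setU//.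
apply: leeD.
- have -> : (\int[P]_(w in A `\` N) `|X n w|%:E =
      \int[P]_(w in A `\` N) (X n w)%:E)%E.
    apply: eq_integral => w; rewrite inE => -[_ /negP].
    by rewrite -leNgt => /ger0_norm ->.
  rewrite (martingale_integral mX np FAP); apply: le_integral => //.
  + exact: iX.
  + by apply: integrable_abse (iX _ _ _).
  + by move=> w _; rewrite lee_fin ler_norm.
- have -> : (\int[P]_(w in A `&` N) `|X n w|%:E =
      \int[P]_(w in A `&` N) - (X n w)%:E)%E.
    by apply: eq_integral => w; rewrite inE => -[_ /ltr0_norm ->].
  have iN k : (\int[P]_(w in A `&` N) - (X k w)%:E =
      - \int[P]_(w in A `&` N) (X k w)%:E)%E.
    exact/integralN/(integrable_add_def mAN)/iX.
  rewrite iN (martingale_integral mX np FAN) -iN.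
  apply: le_integral => //.
  + by apply: integrableN; exact: iX.
  + by apply: integrable_abse (iX _ _ _).
  + by move=> w _; rewrite -EFinN lee_fin -normrN ler_norm.
Qed.

Definition sup_abs (Y : nat -> nat -> T -> R) n w : \bar R :=
  ereal_sup (range (fun i => `|Y i n w|%:E)).

(** ** Maximal inequality for a countable family *)

Section Family.
Variables (Y : nat -> nat -> T -> R) (C : R).
Hypothesis mY : forall i, martingale P F (Y i).
Hypothesis YC : forall n, (\int[P]_w sup_abs Y n w <= C%:E)%E.

Lemma sup_abs_ub i n w : (`|Y i n w|%:E <= sup_abs Y n w)%E.
Proof. by apply: ereal_sup_ubound; exists i. Qed.

Lemma sup_abs_ge0 n w : (0 <= sup_abs Y n w)%E.
Proof. exact: le_trans (sup_abs_ub 0 n w). Qed.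

Lemma measurable_sup_abs n : measurable_fun [set: T] (sup_abs Y n).
Proof.
have -> : sup_abs Y n = (fun w => esups (fun i => `|Y i n w|%:E) 0).
  apply/funext => w; rewrite /sup_abs /esups; congr ereal_sup.
  by apply/seteqP; split => _ [i _ <-]; exists i.
apply: measurable_fun_esups => i; apply/measurable_EFinP.
by apply: measurableT_comp => //; exact: martingale_measurable.
Qed.

Lemma martingale_exceedance (t : R) i n p A : (n <= p)%N -> F n A ->
  A `<=` [set w | t < `|Y i n w|] ->
  (t%:E * P A <= \int[P]_(w in A) sup_abs Y p w)%E.
Proof.
move=> np FA At; have mA := filtration_measurable FA.
have mabs k : measurable_fun A (fun w => `|Y i k w|%:E).
  apply: (measurable_funS measurableT) => //; apply/measurable_EFinP.
  by apply: measurableT_comp => //; exact: martingale_measurable.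
have [t0|t0] := leP 0 t; last first.
  apply: (@le_trans _ _ 0%E).
    by rewrite mule_le0_ge0// lee_fin ltW.
  by apply: integral_ge0 => w _; exact: sup_abs_ge0.
apply: (@le_trans _ _ (\int[P]_(w in A) `|Y i n w|%:E)%E).
  rewrite -(integral_cst _ mA); apply: ge0_le_integral => //.
  by move=> w /At /ltW; rewrite lee_fin.
apply: le_trans (martingale_abs_integral (mY i) np FA) _.
apply: ge0_le_integral => //.
- by apply: measurable_funS (measurable_sup_abs p).
- by move=> w _; exact: sup_abs_ub.
Qed.

(** Cut the event into disjoint pieces according to the first time [n] at which
    some member of the family exceeds [t], then to the first index [i] that
    does. The piece [(n, i)] belongs to [F n], so its probability is controlled
    by the integral of [|Y i p|] over it at any later time [p], and the sum of
    these over all pieces with [n < p] is at most the integral of [sup_abs Y p]. *)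
Theorem maximal_inequality (t : R) : 0 <= t ->
  (t%:E * P (\bigcup_n \bigcup_i [set w | (t < `|Y i n w|)%R]) <= C%:E)%E.
Proof.
move=> t0; pose e n i := [set w | t < `|Y i n w|].
pose E n := \bigcup_i e n i.
have Fe n i : F n (e n i).
  apply: measurable_wrt_gt.
  apply: (measurable_wrt_norm (filtration_sigma_algebra n)).
  by case: (mY i).
have FE n : F n (E n).
  by case: (filtration_sigma_algebra n) => _ _; apply; exact: Fe.
have FA n : F n (seqDU E n).
  by apply: filtration_seqDU => k kn; exact: FE.
have mA n := filtration_measurable (FA n).
have step n p : (n <= p)%N ->
    (t%:E * P (seqDU E n) <= \int[P]_(w in seqDU E n) sup_abs Y p w)%E.
  move=> np; pose B i := seqDU E n `&` seqDU (e n) i.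
  have FB i : F n (B i).
    apply: (sigma_algebraI (filtration_sigma_algebra n)) => //.
    have := @seqDU_measurable _ (g_sigma_algebraType (F n)) (e n).
    rewrite (measurable_g_measurableTypeE (filtration_sigma_algebra n)).
    by apply.
  have mB i := filtration_measurable (FB i).
  have BE : seqDU E n = \bigcup_i B i.
    rewrite -setI_bigcupr -seqDU_bigcup_eq; apply/esym/setIidPl.
    exact: subset_seqDU.
  have tB : trivIset setT B by apply: trivIset_setIl; exact: trivIset_seqDU.
  rewrite {1 2}BE measure_semi_bigcup//; last exact: bigcup_measurable.
  rewrite ge0_integral_bigcup//; last 2 first.
  - apply: measurable_funS (measurable_sup_abs p) => //.
  - by move=> w _; exact: sup_abs_ge0.
  rewrite -nneseriesZl//; apply: lee_nneseries => // i _.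
    by rewrite mule_ge0.
  apply: (martingale_exceedance (i := i) np (FB i)).
  by move=> w [_]; exact: subset_seqDU.
rewrite -/(E _) seqDU_bigcup_eq measure_semi_bigcup//; last exact: bigcup_measurable.
rewrite -nneseriesZl//.
apply: lime_le; first by apply: is_cvg_nneseries => n _ _; rewrite mule_ge0.
apply: nearW => p /=; apply: le_trans (YC p).
apply: (@le_trans _ _ (\sum_(0 <= n < p) \int[P]_(w in seqDU E n) sup_abs Y p w)%E).
  rewrite big_nat_cond [leRHS]big_nat_cond; apply: lee_sum => n.
  by rewrite andbT => /andP[_ /ltnW np]; exact: step.
rewrite -ge0_integral_bigsetU//=.
- apply: ge0_subset_integral => //; first exact: bigsetU_measurable.
    exact: measurable_sup_abs.
  by move=> w _; exact: sup_abs_ge0.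
- exact: iota_uniq.
- by apply: sub_trivIset (trivIset_seqDU E).
- by apply: measurable_funS (measurable_sup_abs p).
- by move=> w _; exact: sup_abs_ge0.
Qed.

End Family.

Lemma ae_bounded_family (Y : nat -> nat -> T -> R) (C : R) :
  (forall i, martingale P F (Y i)) ->
  (forall n, (\int[P]_w sup_abs Y n w <= C%:E)%E) ->
  {ae P, forall w, exists K : R, forall i n, `|Y i n w| <= K}.
Proof.
move=> mY YC; pose S k := \bigcup_n \bigcup_i [set w | k.+1%:R < `|Y i n w|].
have mS k : measurable (S k).
  apply: bigcup_measurable => n _; apply: bigcup_measurable => i _.
  apply: (@filtration_measurable n).
  apply: measurable_wrt_gt.
  apply: (measurable_wrt_norm (filtration_sigma_algebra n)).
  by case: (mY i).
exists (\bigcap_k S k); split; first exact: bigcap_measurable.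
  have C0 : 0 <= C.
    rewrite -lee_fin; apply: le_trans (YC 0); apply: integral_ge0 => w _.
    exact: sup_abs_ge0.
  apply/eqP; rewrite eq_le measure_ge0 andbT; apply/lee_addgt0Pr => e e0.
  rewrite add0e.
  pose k := Num.truncn (C / e).
  have Ck : C / e <= k.+1%:R by apply/ltW/truncnS_gt.
  apply: (@le_trans _ _ (P (S k))).
    apply: le_measure; rewrite ?inE//; first exact: bigcap_measurable.
    exact: bigcap_inf.
  have := maximal_inequality mY YC (ler0n R k.+1).
  rewrite -/(S k) => PS; rewrite -(@lee_pmul2l R k.+1%:R%:E)//.
  apply: (le_trans PS); rewrite -EFinM lee_fin.
  by rewrite -ler_pdivrMr.
move=> w /= Nw k _; apply: contrapT => Sw; apply: Nw.
exists k.+1%:R => i n; rewrite leNgt; apply/negP => lt_k.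
by apply: Sw; exists n => //; exists i.
Qed.

(** ** Upcrossing inequality and convergence *)

Section Upcrossings.
Variables (X : nat -> T -> R) (C p q : R).
Hypothesis mX : martingale P F X.
Hypothesis XC : forall n, (\int[P]_w `|X n w|%:E <= C%:E)%E.
Hypothesis pq : p < q.

(* [A n]: an upcrossing is under way at time [n]. At time [n.+1] it is either
   completed ([B n]) or continued ([D n]), and a new one may start ([L n]). *)
Let A n := [set w | climbing p q (X^~ w) n].
Let B n := A n `&` [set w | q < X n.+1 w].
Let D n := A n `&` ~` [set w | q < X n.+1 w].
Let L n := ~` A n `&` [set w | X n.+1 w < p].

Let AS n : A n.+1 = D n `|` L n.
Proof.
apply/seteqP; rewrite /A /D /L; split => w /=.
  case: ifPn => [Aw xq|/negP Aw xp]; [left|right]; split => //.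
  by apply/negP; rewrite -leNgt.
by move=> [[-> /negP]|[/negP/negbTE ->]]; rewrite -?leNgt.
Qed.

Let ABD n : A n = B n `|` D n.
Proof. by rewrite -setIUr setUv setIT. Qed.

Let FX n : measurable_wrt (F n) (X n).
Proof. by case: mX. Qed.

Let FA n : F n (A n).
Proof.
have FI k := sigma_algebraI (filtration_sigma_algebra k).
have FC k := sigma_algebra_compl (filtration_sigma_algebra k).
elim: n => [|n ih]; first by apply: measurable_wrt_lt; exact: FX.
have FAn : F n.+1 (A n) by exact: filtration_le ih.
rewrite AS; apply: (sigma_algebraU (filtration_sigma_algebra n.+1)).
  by apply: FI => //; apply: FC; apply: measurable_wrt_gt; exact: FX.
by apply: FI; [exact: FC|apply: measurable_wrt_lt; exact: FX].
Qed.

Let mA n : measurable (A n). Proof. exact: filtration_measurable (FA n). Qed.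

Let mXn n : measurable_fun [set: T] (X n).
Proof. exact: martingale_measurable. Qed.

Let mgt n (t : R) : measurable [set w | t < X n w].
Proof. by apply: filtration_measurable (measurable_wrt_gt t (FX n)). Qed.

Let mB n : measurable (B n). Proof. exact: measurableI. Qed.

Let mD n : measurable (D n).
Proof. by apply: measurableI => //; exact: measurableC. Qed.

Let mL n : measurable (L n).
Proof.
apply: measurableI; first exact: measurableC.
exact: filtration_measurable (measurable_wrt_lt p (FX n.+1)).
Qed.

Let iX n E : measurable E -> P.-integrable E (EFin \o X n).
Proof. by move=> mE; apply: (integrableS measurableT) => //; case: mX. Qed.

Let icst (r : R) E : measurable E -> P.-integrable E (EFin \o cst r).
Proof. by move=> mE; apply: finite_measure_integrable_cst. Qed.

Let iXp n E : measurable E -> P.-integrable E (EFin \o (fun w => X n w - p)).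
Proof.
move=> mE.
apply: (eq_integrable _ (fun w => (EFin \o X n) w - (EFin \o cst p) w)%E) => //.
by apply: integrableB => //; [exact: iX|exact: icst].
Qed.

Let J n E := \int[P]_(w in E) (X n w - p).

Let JS n : J n (A n) = J n.+1 (A n).
Proof.
rewrite /J !RintegralB//; [|exact: iX|exact: icst|exact: iX|exact: icst].
by rewrite /Rintegral (martingale_integral mX (leqnSn n) (FA n)).
Qed.

(** The integral of [X n - p] over [A n] does not change when [n] becomes [n.+1]
    in the integrand. Then passing from [A n] to [A n.+1] removes [B n], where
    [X n.+1 - p] is at least [q - p], and adds [L n], where it is negative.
    Summed over time, this is Doob's upcrossing inequality. *)
Let upcrossing_step n :
  (q - p) * fine (P (B n)) + J n.+1 (A n.+1) <= J n (A n).
Proof.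
rewrite (JS n) AS (ABD n) /J Rintegral_setU//; last 2 first.
- by apply: iXp; exact: measurableU.
- by apply/disj_setPS => w [[? _] [? _]].
rewrite Rintegral_setU//; last 2 first.
- by apply: iXp; exact: measurableU.
- by apply/disj_setPS => w [[? ?] [? ?]].
rewrite addrCA [leRHS]addrC lerD2l -[leRHS]addr0 lerD//.
  rewrite -Rintegral_cst//; apply: le_Rintegral => //.
  - exact: icst.
  - exact: iXp.
  - by move=> w [_ /= /ltW qX]; rewrite lerB.
rewrite -[leRHS](mul0r (fine (P (L n)))) -Rintegral_cst//.
apply: le_Rintegral => //.
- exact: iXp.
- exact: icst.
- by move=> w [_ /= /ltW]; rewrite -subr_le0.
Qed.

Let upcrossing_sum n :
  (q - p) * \sum_(0 <= k < n) fine (P (B k)) + J n (A n) <= 0.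
Proof.
elim: n => [|n ih].
  rewrite big_geq// mulr0 add0r /J.
  rewrite -[leRHS](mul0r (fine (P (A 0)))) -Rintegral_cst//.
  apply: le_Rintegral => //; [exact: iXp|exact: icst|].
  by move=> w /= /ltW; rewrite -subr_le0.
apply: le_trans ih; rewrite big_nat_recr//= mulrDr -addrA lerD2l.
exact: upcrossing_step.
Qed.

Let J_ge n : - (C + `|p|) <= J n (A n).
Proof.
rewrite /J RintegralB//; [|exact: iX|exact: icst].
rewrite opprD lerD//.
  rewrite lerNl; apply: (@le_trans _ _ `|\int[P]_(w in A n) X n w|).
    by rewrite -normrN ler_norm.
  apply: le_trans (le_normr_Rintegral _ (iX n _)) _ => //.
  have iabs E : measurable E -> P.-integrable E (EFin \o (fun w => `|X n w|)).
    by move=> mE; exact: integrable_abse (iX n mE).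
  rewrite -lee_fin /Rintegral fineK ?integrable_fin_num//; last exact: iabs.
  apply: le_trans (XC n); apply: ge0_subset_integral => //.
  by apply/measurable_EFinP; exact: measurableT_comp.
rewrite lerN2 Rintegral_cst//; apply: (@le_trans _ _ (`|p| * fine (P (A n)))).
  by rewrite ler_wpM2r ?ler_norm// fine_ge0.
rewrite ler_piMr// -lee_fin fineK ?fin_num_measure//.
exact: probability_le1.
Qed.

(** The probabilities of [B n] are summable, so Borel-Cantelli applies. *)
Lemma finitely_many_upcrossings :
  {ae P, forall w, exists N, forall n, (N <= n)%N ->
    climbing p q (X^~ w) n -> X n.+1 w <= q}.
Proof.
exists (lim_sup_set B); split.
- by apply: bigcap_measurable => // n _; exact: bigcup_measurable.
- apply: lim_sup_set_cvg0 => //.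
  apply: (@le_lt_trans _ _ ((C + `|p|) / (q - p))%:E); last exact: ltry.
  apply: lime_le; first by apply: is_cvg_nneseries.
  apply: nearW => n /=.
  rewrite (eq_bigr (fun k => (fine (P (B k)))%:E)); last first.
    by move=> k _; rewrite fineK// fin_num_measure.
  rewrite sumEFin lee_fin ler_pdivlMr ?subr_gt0// mulrC.
  rewrite -(lerD2r (- (C + `|p|))) subrr.
  by apply: le_trans (upcrossing_sum n); rewrite lerD2l.
move=> w /= Nw n _; apply: contrapT => Bw; apply: Nw; exists n => k nk Ak.
rewrite leNgt; apply/negP => qX; apply: Bw; exists k => //.
Qed.

End Upcrossings.
Lemma ae_forall_countable (I : countType) (Q : I -> T -> Prop) :
  (forall i, {ae P, forall w, Q i w}) -> {ae P, forall w, forall i, Q i w}.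
Proof.
move=> aeQ; pose Q' n w := if unpickle n is Some i then Q i w else True.
have : {ae P, forall w, forall n, Q' n w}.
  apply: ae_foralln => n; rewrite /Q'; case: unpickle => [i|]; first exact: aeQ.
  exact: aeW.
by apply: filterS => w Qw i; have := Qw (pickle i); rewrite /Q' pickleK.
Qed.

(** Boundedness comes from the maximal inequality for a constant family. *)
Theorem martingale_convergence (X : nat -> T -> R) (C : R) :
  martingale P F X -> (forall n, (\int[P]_w `|X n w|%:E <= C%:E)%E) ->
  {ae P, forall w, cvgn (X^~ w)}.
Proof.
move=> mX XC.
have supX n w : sup_abs (fun=> X) n w = `|X n w|%:E.
  rewrite /sup_abs (_ : range _ = [set `|X n w|%:E]) ?ereal_sup1//.
  by apply/seteqP; split => [_ [i _ <-]|_ ->] //; exists 0.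
have bddX : {ae P, forall w, exists K : R, forall i n : nat, `|X n w| <= K}.
  apply: (@ae_bounded_family (fun=> X) C) => // n.
  by under eq_integral do rewrite supX.
have upX : {ae P, forall w, forall pq : rat * rat, ratr pq.1 < ratr pq.2 :> R ->
    exists N, forall n, (N <= n)%N ->
      climbing (ratr pq.1) (ratr pq.2) (X^~ w) n -> X n.+1 w <= ratr pq.2}.
  apply: ae_forall_countable => pq.
  have [pq12|_] := boolP (ratr pq.1 < ratr pq.2 :> R).
    have := finitely_many_upcrossings mX XC pq12.
    by apply: filterS => w ? _.
  exact: aeW.
apply: filterS2 bddX upX => w [K XK] Xw.
apply: (@bounded_cvg_of_upcrossings _ (X^~ w) K) => [n|p q pq]; first exact: (XK 0).
by apply: (Xw (p, q)); rewrite ltr_rat.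
Qed.

End Martingales.

(** * Application to the field *)

(** The integral of a nonnegative function is a supremum over the simple functions
    below it, measurable or not. This matters because [M n] is a supremum over
    uncountably many points. *)
Lemma ge0_le_lower_integral {d : measure_display} {T : measurableType d}
    {R : realType} (mu : {measure set T -> \bar R}) (f g : T -> \bar R) :
  (forall w, 0 <= f w)%E -> (forall w, f w <= g w)%E ->
  (\int[mu]_w f w <= \int[mu]_w g w)%E.
Proof.
move=> f0 fg; rewrite !ge0_integralTE//; last first.
  by move=> w; exact: le_trans (f0 w) (fg w).
by apply: ereal_sup_le => _ [h hf <-]; exists h => // w; exact: le_trans (hf w) (fg w).
Qed.

Lemma ge0_le_lower_integral_ae {d : measure_display} {T : measurableType d}
    {R : realType} (mu : {measure set T -> \bar R}) (f g : T -> \bar R) :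
  measurable_fun [set: T] f ->
  (forall w, 0 <= f w)%E -> (forall w, 0 <= g w)%E ->
  {ae mu, forall w, f w <= g w}%E ->
  (\int[mu]_w f w <= \int[mu]_w g w)%E.
Proof.
move=> mf f0 g0 [N [mN N0 fgN]].
rewrite (@ge0_negligible_integral _ _ _ mu setT N)//.
rewrite integral_mkcond; apply: ge0_le_lower_integral => w.
  by rewrite erestrict_ge0.
rewrite patchE; case: ifPn => // /set_mem [_ Nw].
by apply: contrapT => fgw; apply: Nw; exact: fgN.
Qed.

Section TestMartingales.
Context {R : realType} {d : measure_display} {T : measurableType d}
        {P : probability T R} {F : nat -> set (set T)}.
Hypothesis filtF : filtration F.
Variables (a b : R) (k : nat) (theta : R -> R) (xi : nat -> R -> T -> R).
Let E : set R := `[a, b]%classic.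
Hypothesis ab : a < b.
Hypothesis xi_martingale : forall x, E x -> martingale P F (fun n => xi n x).

Lemma diff_quotient_martingale h l x : 0 < h -> a <= x -> x + l%:R * h <= b ->
  martingale P F (fun n w => diff_quotient h l (fun y => xi n y w) x).
Proof.
move=> h0; elim: l x => [|l ih] x ax xb.
  apply: xi_martingale; rewrite /E /= in_itv/= ax.
  by move: xb; rewrite mul0r addr0.
have lh : l.+1%:R * h = l%:R * h + h by rewrite -[in LHS]addn1 natrD mulrDl mul1r.
have lh0 : 0 <= l%:R * h by rewrite mulr_ge0// ltW.
by apply: (martingale_scale_sub filtF); apply: ih; move: xb; rewrite lh; lra.
Qed.

Lemma zero_martingale : martingale P F (fun _ _ => 0).
Proof.
have Ea : E a by rewrite /E /= in_itv/= lexx ltW.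
rewrite (_ : (fun _ _ => 0) = (fun n w => 0 * (xi n a w - xi n a w))).
  by apply: (martingale_scale_sub filtF); exact: xi_martingale.
by apply/funext => n; apply/funext => w; rewrite mul0r.
Qed.

Lemma test_martingale i :
  martingale P F (fun n w => test a b k theta i (fun x => xi n x w)).
Proof.
case: i => [[[l q] r]|[[[q r] u] j]] /=.
  have [/and4P[_ h0 ax xb]|_] := boolP [&& (l <= k)%N, 0 < ratr r :> R,
    a < ratr q & ratr q + l%:R * ratr r < b]; last exact: zero_martingale.
  by apply: diff_quotient_martingale => //; exact: ltW.
have [/and4P[h0 s0 ax xb]|_] := boolP [&& 0 < ratr r :> R, 0 < ratr u :> R,
  a < ratr q & ratr q + ratr u + k%:R * ratr r < b]; last exact: zero_martingale.
by apply: (martingale_scale_sub filtF); apply: diff_quotient_martingale => //; lra.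
Qed.

End TestMartingales.

Theorem theorem2 (R : realType) (a b : R) (m : nat) (theta : R -> R)
    (d : measure_display) (T : measurableType d) (P : probability T R)
    (F : nat -> set (set T)) (xi : nat -> R -> T -> R) :
  let E : set R := `[a, b]%classic in
  let M (n : nat) (w : T) : \bar R :=
    (normCk m.+1 E (fun x => xi n x w) +
     modulus_ratio_sup E theta
       (derive_in_n m.+1 E (fun x => xi n x w)))%E in
  a < b ->
  modulus_of_continuity theta ->
  measure_is_complete P ->
  filtration F ->
  complete_filtration P F ->
  (forall n, {ae P, forall w, smooth_in m.+1 E (fun x => xi n x w)}) ->
  (forall n, {ae P, forall w,
     admits_modulus E theta (derive_in_n m.+1 E (fun x => xi n x w))}) ->
  (forall x, E x -> martingale P F (fun n => xi n x)) ->
  (ereal_sup (range (fun n => \int[P]_w M n w)) < +oo)%E ->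
  exists xi_lim : R -> T -> R,
    [/\ forall x, E x -> measurable_fun [set: T] (xi_lim x),
        {ae P, forall w, smooth_in m.+1 E (fun x => xi_lim x w)},
        {ae P, forall w, admits_modulus E theta
          (derive_in_n m.+1 E (fun x => xi_lim x w))} &
        {ae P, forall w,
          normCk m E (fun x => xi n x w - xi_lim x w) @[n --> \oo] --> 0%E}].
Proof.
move=> E M ab theta_modulus _ filtF _ xi_smooth _ xi_mart supM.
pose Y i n w := if unpickle i is Some t
  then test a b m.+1 theta t (fun x => xi n x w) else 0.
have mY i : martingale P F (Y i).
  rewrite /Y; case: unpickle => [t|].
    exact: (test_martingale filtF _ _ ab xi_mart t).
  exact: (zero_martingale filtF ab xi_mart).
have M_ge0 n w : (0 <= M n w)%E.
  by rewrite adde_ge0 ?normCk_ge0// modulus_ratio_sup_ge0.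
have Y_le_M n w : smooth_in m.+1 E (fun x => xi n x w) -> (sup_abs Y n w <= M n w)%E.
  move=> smooth; apply: ge_ereal_sup => _ [i _ <-]; rewrite /Y.
  by case: unpickle => [t|]; rewrite ?normr0//; exact: test_le_norm.
have [C YC] : exists C : R, forall n, (\int[P]_w sup_abs Y n w <= C%:E)%E.
  move: supM; set S := ereal_sup _ => supM.
  have intM n : (\int[P]_w M n w <= S)%E by apply: ereal_sup_ubound; exists n.
  exists (fine S) => n.
  rewrite fineK; last first.
    rewrite ge0_fin_numE//; apply: le_trans (intM 0).
    by apply: integral_ge0 => w _; exact: M_ge0.
  apply: le_trans (intM n); apply: ge0_le_lower_integral_ae => //.
  - exact: (measurable_sup_abs mY).
  - by move=> w; exact: sup_abs_ge0.
  - by apply: filterS (xi_smooth n) => w; exact: Y_le_M.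
have ae_bounded := ae_bounded_family filtF mY YC.
have ae_cvg : {ae P, forall w, forall i : nat, cvgn (fun n => Y i n w)}.
  apply: ae_foralln => i; apply: (martingale_convergence filtF (C := C) (mY i)).
  move=> n; apply: le_trans (YC n); apply: ge0_le_lower_integral => w //.
  exact: sup_abs_ub.
have ae_smooth : {ae P, forall w, forall n, smooth_in m.+1 E (fun x => xi n x w)}.
  exact: ae_foralln.
(* Outside of the measurable null set [N] everything used below holds; the
   factor [\1_(~` N)] makes the sequence defining [xi_lim] converge everywhere,
   so that its limit is measurable. *)
have [N [mN N0 goodN]] := filterI (filterI ae_smooth ae_bounded) ae_cvg.
pose xi_lim x w := limn (fun n => xi n x w * \1_(~` N) w).
have indicN w : ~ N w -> \1_(~` N) w = 1 :> R.
  by move=> Nw; rewrite indicE mem_set.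
have lim_good w : ~ N w ->
  [/\ forall x, E x -> cvgn (fun n => xi n x w),
    smooth_in m.+1 E (fun x => xi_lim x w),
    admits_modulus E theta (derive_in_n m.+1 E (fun x => xi_lim x w)) &
    forall j, (j <= m.+1)%N ->
      normCk j E (fun x => xi n x w - xi_lim x w) @[n --> \oo] --> 0%E].
  move=> Nw; have [[smooth [K YK]] Ycvg] := contrapT (fun bad => Nw (goodN w bad)).
  apply: (smooth_limit ab theta_modulus (K := K)) => //.
  - by move=> n t; have := YK (pickle t) n; rewrite /Y pickleK.
  (* A test of order [0] is the evaluation at [ratr q]; any
     positive step would do. *)
  - move=> q /andP[aq qb]; have := Ycvg (pickle (inl (0, q, 1) : test_index)).
    by rewrite /Y pickleK /= rmorph1 ltr01 mul0r addr0 aq qb.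
  - move=> x Ex _; apply: (congr1 (fun u : nat -> R => limn u)).
    by apply/funext => n; rewrite indicN// mulr1.
have ae_good (Q : T -> Prop) : (forall w, ~ N w -> Q w) -> {ae P, forall w, Q w}.
  by move=> NQ; exists N; split=> // w /= nQ; apply: contrapT => /NQ.
exists xi_lim; split.
- move=> x Ex; apply: (@measurable_fun_cvg _ _ _ _ (fun n w => xi n x w * \1_(~` N) w)).
    move=> n; apply: measurable_funM; last exact/measurable_indic/measurableC.
    exact: (martingale_measurable n (xi_mart x Ex)).
  move=> w _; change (cvgn (fun n => xi n x w * \1_(~` N) w)).
  have [Nw|Nw] := pselect (N w).
    rewrite indicE memNset; last by move=> nNw; exact: nNw.
    by under eq_fun do rewrite mulr0; exact: is_cvg_cst.
  by apply: is_cvgMl; have [+ _ _ _] := lim_good _ Nw; exact.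
- by apply: ae_good => w /lim_good[].
- by apply: ae_good => w /lim_good[].
- by apply: ae_good => w /lim_good[_ _ _]; apply.
Qed.
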